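(* Let $Y$ be a non-empty subset of a path-connected pointed space $(X,x_0)$. Then $$\operatorname{cat}(X)\le\operatorname{TC}(X,Y)\le\operatorname{TC}(X)\le\operatorname{cat}(X\times X).$$
   Context: For a continuous map (fibration) $f:E\to B$, the Schwarz genus $\operatorname{genus}(f)$ is the smallest $k$ such that $B$ has an open cover $U_1,\dots,U_k$ for which each $U_i$ admits a continuous section $s_i:U_i\to E$ of $f$ (and $\infty$ if there is no such $k$). For a space $X$ and $Y\subseteq X$, let $P_{X\times Y}$ be the space of continuous paths $\gamma:[0,1]\to X$ with $\gamma(1)\in Y$, and let $\pi:P_{X\times Y}\to X\times Y$, $\pi(\gamma)=(\gamma(0),\gamma(1))$. The relative topological complexity of the pair is $\operatorname{TC}(X,Y)=\operatorname{genus}(\pi)$. The topological complexity of $X$ is $\operatorname{TC}(X)=\operatorname{genus}(p)$, where $p:PX\to X\times X$, $p(\sigma)=(\sigma(0),\sigma(1))$, and $PX$ is the space of all paths in $X$ (unreduced convention). For a pointed space $(X,x_0)$, let $P_0X$ be the space of paths $\sigma$ in $X$ with $\sigma(1)=x_0$ and $p_0:P_0X\to X\times\{x_0\}$, $p_0(\sigma)=(\sigma(0),x_0)$. The Lusternik-Schnirelmann category is $\operatorname{cat}(X)=\operatorname{genus}(p_0)$; for path-connected $X$ it does not depend on $x_0$. *)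

(* Defs.v *)
From HB Require Import structures.
From mathcomp Require Import all_boot all_order all_algebra.
From mathcomp Require Import all_classical all_reals ereal topology.
From mathcomp Require Import normedtype continuous_path.

Set Implicit Arguments.
Unset Strict Implicit.
Unset Printing Implicit Defensive.

Import Order.TTheory GRing.Theory Num.Theory.
Import numFieldNormedType.Exports.

Local Open Scope classical_set_scope.
Local Open Scope ring_scope.

Definition unit_interval (R : realType) : Type := set_type (`[0, 1]%classic : set R).

HB.instance Definition _ (R : realType) :=
  Topological.copy (unit_interval R) (set_type (`[0, 1]%classic : set R)).

Section unit_interval_bipointed.
Context (R : realType).

Let mem0 : (0 : R) \in (`[0, 1]%classic : set R).
Proof. by apply/mem_set; rewrite /= in_itv /= lexx ler01. Qed.

Let mem1 : (1 : R) \in (`[0, 1]%classic : set R).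
Proof. by apply/mem_set; rewrite /= in_itv /= lexx ler01. Qed.

Let I0 : unit_interval R := exist _ 0 mem0.
Let I1 : unit_interval R := exist _ 1 mem1.

Let I01 : I0 != I1.
Proof. by apply/eqP => -[] /esym/eqP; rewrite oner_eq0. Qed.

HB.instance Definition _ := isBiPointed.Build (unit_interval R) I01.

End unit_interval_bipointed.

Definition path_connected (R : realType) (X : topologicalType) : Prop :=
  $| X | /\ forall x y : X, $| {path (unit_interval R) from x to y} |.

Definition path_space (R : realType) (X : topologicalType) : Type :=
  continuousType (unit_interval R) X.

HB.instance Definition _ (R : realType) (X : topologicalType) :=
  Choice.copy (path_space R X) (continuousType (unit_interval R) X).

HB.instance Definition _ (R : realType) (X : topologicalType) :=
  Topological.copy (path_space R X)
    (initial_topology ((fun g : path_space R X => g : _ -> _)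
      : path_space R X -> {compact-open, unit_interval R -> X})).

Section genus.
Context (E B : topologicalType) (f : E -> B).

(* Sections are defined on the subtype U, so that empty members of the cover
   are harmless even when E itself is empty. *)
Definition has_section (U : set B) : Prop :=
  exists s : set_type U -> E, continuous s /\ forall b, f (s b) = set_val b.

Definition section_cover (k : nat) : Prop :=
  exists U : 'I_k -> set B,
    [/\ forall i, open (U i),
        \bigcup_i U i = [set: B] &
        forall i, has_section (U i)].

(* An infimum of natural numbers is attained unless the set is empty, in which
   case ereal_inf is +oo. *)
Definition genus (R : realType) : \bar R :=
  ereal_inf [set k%:R%:E | k in section_cover].

End genus.

Section invariants.
Context (R : realType) (X : topologicalType).

Definition rel_path_space (Y : set X) : Type :=
  set_type [set g : path_space R X | Y (g one)].

HB.instance Definition _ (Y : set X) :=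
  Topological.copy (rel_path_space Y)
    (set_type [set g : path_space R X | Y (g one)]).

Definition rel_endpoints (Y : set X) (g : rel_path_space Y) :
    (X * set_type Y)%type :=
  (set_val g zero, exist _ (set_val g one) (mem_set (set_valP g))).

Definition relTC (Y : set X) : \bar R := genus (@rel_endpoints Y) R.

Definition endpoints (g : path_space R X) : (X * X)%type := (g zero, g one).

Definition TC : \bar R := genus endpoints R.

Definition based_path_space (x0 : X) : Type :=
  set_type [set g : path_space R X | g one = x0].

HB.instance Definition _ (x0 : X) :=
  Topological.copy (based_path_space x0)
    (set_type [set g : path_space R X | g one = x0]).

Definition based_endpoints (x0 : X) (g : based_path_space x0) :
    (X * set_type [set x0])%type :=
  (set_val g zero, exist _ x0 (mem_set (erefl x0))).

Definition LScat (x0 : X) : \bar R := genus (@based_endpoints x0) R.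

End invariants.

(* Main.v *)
Require Import Defs.
From mathcomp Require Import all_boot all_order all_algebra.
From mathcomp Require Import all_classical all_reals ereal topology.
From mathcomp Require Import normedtype continuous_path lra.

Import Order.TTheory GRing.Theory Num.Theory numFieldNormedType.Exports.

Local Open Scope classical_set_scope.
Local Open Scope ereal_scope.

(** All three inequalities come from one principle, [genus_le]: the genus can
only drop when a map is replaced by one that receives a map from its
pullback.  If [h : B' -> B] is continuous and every point of [B'], together
with a point of [E] over its image, determines continuously a point of [E']
over it, then an open cover of [B] with sections of [f : E -> B] pulls back
along [h] to an open cover of [B'] with sections of [g : E' -> B'].  For path
fibrations this reads as follows.

- [cat(X) <= TC(X,Y)]: fix [y0] in [Y] and a path [delta] from [x0] to [y0].
  Pull back along [x |-> (x, y0)]; a path from [x] to [y0] followed by [delta]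
  reversed is a path from [x] to [x0].
- [TC(X,Y) <= TC(X)]: pull back along the inclusion of [X * Y] in [X * X];
  a path ending at a point of [Y] is a point of the relative path space.
- [TC(X) <= cat(X * X)]: a path in [X * X] from [(x, y)] to [(x0, x0)] is a
  pair of paths, from [x] to [x0] and from [y] to [x0]; the first followed by
  the second reversed is a path from [x] to [y].

The first and third cases use the same operation, gluing two paths with a
common end point.  Its continuity is easiest to see on homotopies: because the
interval is compact and regular, continuous families of paths indexed by [T]
are the same as continuous maps on [T * I] ([path_uncurry_continuous] and
[path_curry]), and there gluing is the pasting lemma for two closed sets. *)

(** * Monotonicity of the genus under pullback *)

Lemma set_val_continuous (T : topologicalType) (A : set T) :
  continuous (set_val : set_type A -> T).
Proof. exact: initial_continuous. Qed.

Lemma pair_continuous (T U V : topologicalType) (f : T -> U) (g : T -> V) :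
  continuous f -> continuous g -> continuous (fun t => (f t, g t)).
Proof.
by move=> f_cts g_cts t; apply: cvg_pair; [exact: f_cts | exact: g_cts].
Qed.

(** The points of [B'] and [E] are taken as continuous families over an
arbitrary space [T]: this says that there is a continuous map over [B'] from
the pullback of [f] along [h] to [E'], without forming the pullback space. *)
Lemma genus_le (E B E' B' : topologicalType) (f : E -> B) (g : E' -> B')
    (h : B' -> B) (R : realType) :
  continuous h ->
  (forall (T : topologicalType) (b : T -> B') (e : T -> E),
     continuous b -> continuous e -> (forall t, f (e t) = h (b t)) ->
     exists2 e' : T -> E', continuous e' & forall t, g (e' t) = b t) ->
  genus g R <= genus f R.
Proof.
move=> h_cts lift; apply: ereal_inf_le_tmp => _ [k [U [Uo Ucov Us]] <-].
exists k => //; exists (fun i => h @^-1` U i); split=> [i||i].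
- by apply: open_comp; [move=> x _; exact: h_cts | exact: Uo].
- by rewrite -preimage_bigcup Ucov preimage_setT.
have [s [s_cts sK]] := Us i.
pose hU (b : set_type (h @^-1` U i)) : set_type (U i) :=
  exist _ (h (set_val b)) (mem_set (set_valP b)).
have hU_cts : continuous hU.
  apply: continuous_comp_initial => b.
  apply: (@continuous_comp _ _ _ set_val h); last exact: h_cts.
  exact: set_val_continuous.
have [||b|e' e'_cts e'K] := lift _ set_val (s \o hU).
- exact: set_val_continuous.
- by move=> b; apply: continuous_comp; [exact: hU_cts | exact: s_cts].
- by rewrite /= sK.
by exists e'.
Qed.

(** * The unit interval *)

Section interval.
Variable R : realType.
Local Open Scope ring_scope.

Lemma clamp_subproof (r : R) :
  Num.max 0 (Num.min 1 r) \in (`[0, 1]%classic : set R).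
Proof.
apply/mem_set; rewrite /= in_itv /= le_max lexx /= ge_max ler01 /=.
by rewrite ge_min lexx.
Qed.

(** The retraction of the line onto the interval.  Writing reparametrizations
as [clamp] of an affine function makes them total and continuous, so that they
need not be restricted to half of the interval. *)
Definition clamp (r : R) : unit_interval R :=
  exist (fun s => s \in `[0, 1]%classic) _ (clamp_subproof r).

Lemma clamp_continuous : continuous clamp.
Proof.
apply: continuous_comp_initial => r.
apply: (@continuous_max R R (cst 0) (fun r => Num.min 1 r)).
  exact: cst_continuous.
by apply: (@continuous_min R R (cst 1) id) => //; exact: cst_continuous.
Qed.

Lemma set_val_zero : set_val (zero : unit_interval R) = 0 :> R.
Proof. by []. Qed.

Lemma set_val_one : set_val (one : unit_interval R) = 1 :> R.
Proof. by []. Qed.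

Lemma clampK (r : unit_interval R) : clamp (set_val r) = r.
Proof.
apply: val_inj; have := set_valP r; rewrite /= in_itv /= => /andP[r0 r1].
by rewrite (min_idPr r1) (max_idPr r0).
Qed.

Lemma clamp_le0 (r : R) : r <= 0 -> clamp r = zero.
Proof.
move=> r0; apply: val_inj => /=; rewrite (min_idPr (le_trans r0 ler01)).
exact/max_idPl.
Qed.

Lemma clamp_ge1 (r : R) : 1 <= r -> clamp r = one.
Proof.
by move=> r1; apply: val_inj => /=; rewrite (min_idPl r1); exact/max_idPr/ler01.
Qed.

Lemma unit_interval_compact : compact [set: unit_interval R].
Proof.
have -> : [set: unit_interval R] = clamp @` `[0, 1].
  by apply/seteqP; split=> // r _; exists (set_val r);
    [exact: set_valP | exact: clampK].
apply: continuous_compact; last exact: segment_compact.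
exact/continuous_subspaceT/clamp_continuous.
Qed.

Lemma unit_interval_locally_compact : locally_compact [set: unit_interval R].
Proof.
move=> r _; rewrite withinET; exists setT; first exact: filterT.
by split; [exact: unit_interval_compact | exact: closedT].
Qed.

End interval.

(** * Families of paths as homotopies *)

Section families.
Variables (R : realType) (T X : topologicalType).
Local Open Scope ring_scope.

Lemma path_uncurry_continuous (e : T -> path_space R X) :
  continuous e ->
  continuous (fun z : T * unit_interval R => (e z.1 : _ -> _) z.2).
Proof.
move=> e_cts.
rewrite [X in continuous X](_ : _ = uncurry (fun t => e t : _ -> _));
  last by apply/funext => -[].
apply: continuous_uncurry_regular.
- exact: unit_interval_locally_compact.
- exact: uniform_regular.
- move=> t; apply: (@continuous_comp _ _ _ e
    (fun g => g : {compact-open, unit_interval R -> X})); first exact: e_cts.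
  exact: initial_continuous.
- by move=> t; exact: cts_fun.
Qed.

Lemma path_curry (H : T * unit_interval R -> X) :
  continuous H ->
  exists2 e : T -> path_space R X,
    continuous e & forall t r, (e t : _ -> _) r = H (t, r).
Proof.
move=> /continuous_curry[curry_cts H_cts].
exists (fun t => mkcts (H_cts t)) => //.
exact: continuous_comp_initial.
Qed.

(** Two families with a common end are glued, rather than a family ending where
the next one starts, because every pair of paths to be joined arises in this
form: no separate reversal of paths is then needed. *)
Lemma glue_continuous (H K : T * unit_interval R -> X) :
  continuous H -> continuous K ->
  (forall t, H (t, one) = K (t, one)) ->
  continuous (fun z : T * unit_interval R =>
    if set_val z.2 <= 2^-1 then H (z.1, clamp R (2 * set_val z.2))
    else K (z.1, clamp R (2 - 2 * set_val z.2))).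
Proof.
move=> H_cts K_cts HK; set G := (G in continuous G).
pose p (z : T * unit_interval R) : R := set_val z.2.
have p_cts : continuous p.
  move=> z; apply: continuous_comp; first exact: cvg_snd.
  exact: set_val_continuous.
have reparam_cts (L : T * unit_interval R -> X) (phi : R -> R) :
    continuous L -> continuous phi ->
    continuous (fun z => L (z.1, clamp R (phi (p z)))).
  move=> L_cts phi_cts z.
  apply: (@continuous_comp _ _ _ (fun z => (z.1, clamp R (phi (p z)))) L);
    last exact: L_cts.
  apply: pair_continuous => {}z; first exact: cvg_fst.
  apply: (@continuous_comp _ _ _ (phi \o p) (clamp R));
    last exact: clamp_continuous.
  by apply: continuous_comp; [exact: p_cts | exact: phi_cts].
have G_le z : p z <= 2^-1 -> G z = H (z.1, clamp R (2 * p z)).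
  by rewrite /G -/(p z) => ->.
have G_ge z : 2^-1 <= p z -> G z = K (z.1, clamp R (2 - 2 * p z)).
  (* The two formulas agree at time 1/2, where [HK] applies. *)
  rewrite /G -/(p z) => z_ge; case: ifP => // z_le.
  have pz : p z = 2^-1 by apply/eqP; rewrite eq_le z_ge z_le.
  by rewrite pz !clamp_ge1 ?HK //; lra.
have double_cts : continuous (fun r : R => 2 * r) by exact: mulrl_continuous.
have H2_cts := reparam_cts H _ H_cts double_cts.
have K2_cts : continuous (fun z => K (z.1, clamp R (2 - 2 * p z))).
  apply: (reparam_cts K (fun r => 2 - 2 * r)) => // r.
  by apply: cvgB; [exact: cvg_cst | exact: double_cts].
apply/continuous_subspace_setT.
have -> : [set: T * unit_interval R] =
    p @^-1` [set r | r <= 2^-1] `|` p @^-1` [set r | 2^-1 <= r].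
  by apply/seteqP; split=> // z _ /=; exact/orP/le_total.
apply: withinU_continuous.
- by apply: preimage_closed; [move=> z _; exact: p_cts | exact: closed_le].
- by apply: preimage_closed; [move=> z _; exact: p_cts | exact: closed_ge].
- apply: (subspace_eq_continuous _ (continuous_subspaceT H2_cts)) => z.
  by rewrite inE => z_le; exact/esym/G_le.
- apply: (subspace_eq_continuous _ (continuous_subspaceT K2_cts)) => z.
  by rewrite inE => z_ge; exact/esym/G_ge.
Qed.

Lemma path_glue (H K : T * unit_interval R -> X) :
  continuous H -> continuous K ->
  (forall t, H (t, one) = K (t, one)) ->
  exists2 e : T -> path_space R X, continuous e &
    forall t, (e t : _ -> _) zero = H (t, zero) /\
              (e t : _ -> _) one = K (t, zero).
Proof.
move=> H_cts K_cts HK.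
have [e e_cts eE] := path_curry _ (glue_continuous H K H_cts K_cts HK).
exists e => // t; rewrite !eE /= set_val_zero set_val_one; split.
  by rewrite ifT ?clamp_le0 //; lra.
by rewrite ifF ?clamp_le0 //; lra.
Qed.

End families.

(** * The three inequalities *)

Section inequalities.
Variables (R : realType) (X : topologicalType).

Lemma LScat_le_relTC (x0 y0 : X) (Y : set X)
    (delta : {path (unit_interval R) from x0 to y0}) :
  Y y0 -> LScat R x0 <= relTC R Y.
Proof.
move=> Yy0; pose y0' : set_type Y := exist _ y0 (mem_set Yy0).
apply: (@genus_le _ _ _ _ _ _ (fun b : X * set_type [set x0] => (b.1, y0'))).
  by apply: pair_continuous => b; [exact: cvg_fst | exact: cvg_cst].
move=> T b e b_cts e_cts eE.
have gamma_cts : continuous (fun t => set_val (e t) : path_space R X).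
  by move=> t; apply: continuous_comp; [exact: e_cts|exact: set_val_continuous].
have [||t|d d_cts dE] := path_glue R T X
  (fun z => (set_val (e z.1) : _ -> _) z.2) (fun z => delta z.2).
- exact: (path_uncurry_continuous _ _ _ _ gamma_cts).
- move=> z; apply: continuous_comp; [exact: cvg_snd | exact: cts_fun].
- by have [_ /= ->] := eE t; rewrite path_one.
have d1 t : (d t : _ -> _) one = x0 by rewrite (dE t).2 path_zero.
exists (fun t => exist _ (d t) (mem_set (d1 t)) : based_path_space R x0).
  exact: continuous_comp_initial.
move=> t; rewrite /based_endpoints /= (dE t).1.
have [-> _] := eE t; case: (b t) => x [y yx0] /=; congr pair.
by apply: val_inj; rewrite /= (set_mem yx0).
Qed.

Lemma relTC_le_TC (Y : set X) : relTC R Y <= TC R X.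
Proof.
apply: (@genus_le _ _ _ _ _ _ (fun b : X * set_type Y => (b.1, set_val b.2))).
  apply: pair_continuous => b; first exact: cvg_fst.
  by apply: continuous_comp; [exact: cvg_snd | exact: set_val_continuous].
move=> T b e b_cts e_cts eE.
have e1 t : Y ((e t : _ -> _) one).
  by have [_ ->] := eE t; exact: set_valP.
exists (fun t => exist _ (e t) (mem_set (e1 t)) : rel_path_space R Y).
  exact: continuous_comp_initial.
move=> t; rewrite [RHS]surjective_pairing /rel_endpoints.
have [e0 e1t] := eE t; congr pair; first exact: e0.
exact: val_inj.
Qed.

Lemma TC_le_LScat_square (x0 : X) : TC R X <= LScat R ((x0, x0) : X * X).
Proof.
pose pt : set_type [set ((x0, x0) : (X * X)%type)] :=
  exist (fun p => p \in [set (x0, x0)]) (x0, x0) (mem_set erefl).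
apply: (@genus_le _ _ _ _ _ _ (fun b : X * X => (b, pt))).
  by apply: pair_continuous => b; [exact: cvg_id | exact: cvg_cst].
move=> T b e b_cts e_cts eE.
have gamma_cts : continuous (fun t => set_val (e t) : path_space R (X * X)%type).
  by move=> t; apply: continuous_comp; [exact: e_cts|exact: set_val_continuous].
pose Gamma (z : T * unit_interval R) := (set_val (e z.1) : _ -> _) z.2.
have Gamma_cts : continuous Gamma.
  exact: (path_uncurry_continuous _ _ _ _ gamma_cts).
have [||t|d d_cts dE] := path_glue R T X (fst \o Gamma) (snd \o Gamma).
- by move=> z; apply: continuous_comp; [exact: Gamma_cts | exact: cvg_fst].
- by move=> z; apply: continuous_comp; [exact: Gamma_cts | exact: cvg_snd].
- by rewrite /Gamma /= (set_valP (e t)).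
exists d => // t; rewrite /endpoints (dE t).1 (dE t).2 -surjective_pairing.
by have [] := eE t.
Qed.

End inequalities.

Theorem proposition3p4 (R : realType) (X : topologicalType) (x0 : X)
    (Y : set X) :
  path_connected R X -> Y !=set0 ->
  [/\ LScat R x0 <= relTC R Y,
      relTC R Y <= TC R X &
      TC R X <= LScat R ((x0, x0) : (X * X)%type)].
Proof.
move=> [_ X_conn] [y0 Yy0]; have [delta] := X_conn x0 y0; split.
- exact: (LScat_le_relTC R X x0 y0 Y delta).
- exact: relTC_le_TC.
- exact: TC_le_LScat_square.
Qed.
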